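(* Let $p$ be a prime number and let $G$ be a finite, simple, undirected, connected graph. Then $G$ is zero-forcing for the cyclic group $\mathbb{Z}_p$ if and only if $G$ has at least $p$ vertices.
   Context: For a finite abelian group $(\mathcal G,+,0)$, a $\mathcal G$-labeling of a graph $G$ is a map $\ell: V(G)\to\mathcal G$, extended to vertex sets by $\ell(A)=\sum_{x\in A}\ell(x)$. A set $A\subseteq V(G)$ is called connected if the induced subgraph $G[A]$ is connected. The labeled graph $(G,\ell)$ is zero-avoiding if $\ell(A)\neq 0$ for every non-empty connected $A\subseteq V(G)$. The graph $G$ is zero-forcing for $\mathcal G$ if there is no $\mathcal G$-labeling $\ell$ of $G$ such that $(G,\ell)$ is zero-avoiding. $\mathbb{Z}_p$ denotes the integers modulo $p$. *)

(* Defs.v *)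
From mathcomp Require Import all_boot all_order all_algebra.
Set Implicit Arguments.
Unset Strict Implicit.
Unset Printing Implicit Defensive.

Import GRing.Theory.
Local Open Scope ring_scope.

(* A finite simple undirected graph is a symmetric irreflexive relation on a
   finType. The graph on the empty vertex set counts as connected. *)
Definition simple_graph (T : finType) (e : rel T) : Prop :=
  symmetric e /\ irreflexive e.

Definition connected_graph (T : finType) (e : rel T) : Prop :=
  forall x y : T, connect e x y.

Definition induced (T : finType) (e : rel T) (A : {set T}) :
    rel {x : T | x \in A} :=
  fun u v => e (val u) (val v).

Definition connected_set (T : finType) (e : rel T) (A : {set T}) : Prop :=
  connected_graph (@induced T e A).

Definition label_sum (M : finZmodType) (T : finType) (l : T -> M)
    (A : {set T}) : M :=
  \sum_(x in A) l x.

Definition zero_avoiding (M : finZmodType) (T : finType) (e : rel T)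
    (l : T -> M) : Prop :=
  forall A : {set T}, A != set0 -> connected_set e A -> label_sum l A != 0.

Definition zero_forcing (M : finZmodType) (T : finType) (e : rel T) : Prop :=
  ~ exists l : T -> M, zero_avoiding e l.

(* Main.v *)
Require Import Defs.
From mathcomp Require Import all_boot all_order all_algebra zify.

(** The constant labeling 1 avoids zero on fewer than [p] vertices.
    Conversely, let [l] be zero-avoiding and take a spanning tree rooted at [v].
    By induction along the tree, the sums of the subtrees containing the root
    take at least [min(p, n)] values: grafting a tree [W] onto a tree [U]
    lets one add any root-containing subtree sum of [W], or nothing, and 0 is
    not among the sums of [W], so Cauchy-Davenport gives
    [|S_U + (0 |: S_W)| >= min(p, |S_U| + |S_W|)]. If [n >= p], then every
    residue, in particular 0, is a sum. *)

Set Implicit Arguments.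
Unset Strict Implicit.
Unset Printing Implicit Defensive.

Import GRing.Theory.
Local Open Scope ring_scope.

Section CauchyDavenport.

Variable p : nat.
Hypothesis p_prime : prime p.

Lemma card_Zp_prime : #|{: 'Z_p}| = p.
Proof. by rewrite card_ord Zp_cast ?prime_gt1. Qed.

(** As [p] is prime, [d] is invertible, so the multiples of [d] added to [a] reach every residue. *)
Lemma translation_closed_setT (A : {set 'Z_p}) (a d : 'Z_p) :
  a \in A -> d != 0 -> {in A, forall x, x + d \in A} -> A = setT.
Proof.
move=> aA d0 Ad; apply/setP => y; rewrite inE.
have p1 := prime_gt1 p_prime.
have aAk k : a + d *+ k \in A.
  elim: k => [|k IHk]; first by rewrite mulr0n addr0.
  by rewrite mulrSr addrA Ad.
have dU : d \is a GRing.unit.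
  rewrite -(natr_Zp d) unitZpE // prime_coprime //; apply: contra d0 => pd.
  have dp : (d < p)%N by rewrite -[X in (_ < X)%N](Zp_cast p1).
  by case: (posnP d) => [d0|d_gt0]; [apply/eqP/val_inj | rewrite gtnNdvd in pd].
(* The quotient of [y - a] by [d] is a residue, read here as a natural number of repetitions. *)
have -> : y = a + d *+ (d^-1 * (y - a))%R.
  by rewrite -mulr_natr natr_Zp mulVKr // addrC subrK.
exact: aAk.
Qed.

Definition sumset (A B : {set 'Z_p}) : {set 'Z_p} :=
  [set x + y | x in A, y in B].

(* Dyson's transform: [(A, B)] is replaced by
   [(A :|: (a + B), B :&: (A - a))] with [a + b \notin A]. *)
Lemma Cauchy_Davenport (A B : {set 'Z_p}) :
  A != set0 -> 0 \in B -> (minn p (#|A| + #|B|).-1 <= #|sumset A B|)%N.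
Proof.
have [n] := ubnP #|B|; elim: n A B => // n IHn A B ltBn A0 B0.
have sAAB : A \subset sumset A B.
  by apply/subsetP => x xA; rewrite -[x]addr0; apply: imset2_f.
have [a0 a0A] := set0Pn _ A0.
have [B_eq|[b bB b0]] : #|B| = 1%N \/ exists2 b, b \in B & b != 0.
- case: (set_0Vmem (B :\ 0)) => [BE|[b]].
    by left; rewrite (cardsD1 0) B0 BE cards0.
  by rewrite !inE => /andP[b0 bB]; right; exists b.
- by rewrite B_eq addn1 geq_min (subset_leq_card sAAB) orbT.
have [/forall_inP Ab|] := boolP [forall x in A, x + b \in A].
  have AT := translation_closed_setT a0A b0 Ab.
  by rewrite geq_min -[X in (X <= _)%N]card_Zp_prime -cardsT -AT subset_leq_card.
rewrite negb_forall_in => /exists_inP[a aA abA].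
pose A' := A :|: [set a + x | x in B].
pose B' := B :&: [set x | a + x \in A].
(* Translation by [a] carries [B'] onto the intersection of [A] and [a + B], while [A'] is their
   union; hence the transform preserves the total size. *)
have cB' : #|B'| = #|A :&: [set a + x | x in B]|.
  rewrite -(card_imset B' (addrI a)); congr #|pred_of_set _|.
  apply/setP => z; apply/imsetP/setIP.
    move=> [x]; rewrite !inE => /andP[xB axA] ->; split=> //.
    exact: imset_f.
  by move=> [zA /imsetP[x xB zE]]; exists x => //; rewrite !inE xB -zE.
have cAB : (#|A'| + #|B'| = #|A| + #|B|)%N.
  by rewrite cB' cardsUI (card_imset _ (addrI a)).
have ltB' : (#|B'| < #|B|)%N.
  apply: proper_card; apply/properP; split; first exact: subsetIl.
  by exists b => //; rewrite !inE (negPf abA) andbF.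
have A'0 : A' != set0 by apply/set0Pn; exists a; rewrite inE aA.
have B'0 : 0 \in B' by rewrite !inE B0 addr0.
have := IHn A' B' (leq_trans ltB' ltBn) A'0 B'0.
rewrite cAB => /leq_trans; apply; apply: subset_leq_card.
(* For [x = a + z] with [z] in [B], exchange the summands: [(a + z) + y = (a + y) + z], where
   [a + y] is in [A] because [y] is in [B']. *)
apply/subsetP => _ /imset2P[x y xA' + ->]; rewrite !inE => /andP[yB ayA].
move: xA'; rewrite inE => /orP[xA|/imsetP[z zB ->]]; first exact: imset2_f.
by rewrite addrAC; apply: imset2_f.
Qed.

End CauchyDavenport.

Section RootedTrees.

Variables (T : finType) (e : rel T).

(** Only the vertex set of the tree is kept. Each graft happens at the root, so that the sums over
    subtrees containing the root decompose as a sumset. *)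
Inductive rooted_tree : T -> {set T} -> Prop :=
| Root v : rooted_tree v [set v]
| Graft v w U W : rooted_tree v U -> rooted_tree w W -> e v w ->
    [disjoint U & W] -> rooted_tree v (U :|: W).

Lemma rooted_tree_root v U : rooted_tree v U -> v \in U.
Proof. by elim=> [w|w x U' W _ wU _ _ _ _]; rewrite inE ?wU. Qed.

(** Since [Graft] attaches only at the root, the new leaf is pushed down recursively into the part
    that contains [u]. *)
Lemma rooted_tree_add_leaf v U u w :
  rooted_tree v U -> u \in U -> w \notin U -> e u w ->
  rooted_tree v (w |: U).
Proof.
move=> tU; elim: tU u => {v U} [v|v x U W tU IHU tW IHW vx dUW] u.
  rewrite !inE => /eqP-> wv vw; rewrite setUC; apply: (@Graft _ w) => //.
  - exact: Root.
  - exact: Root.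
  - by rewrite disjoint_sym disjoints1 inE.
rewrite !inE negb_or => uUW /andP[wU wW] uw; case/orP: uUW => [uU|uW].
  rewrite setUA; apply: (@Graft _ x) => //; first exact: (IHU u).
  by rewrite disjoints_subset subUset sub1set inE wW -disjoints_subset.
rewrite setUCA; apply: (@Graft _ x) => //; first exact: (IHW u).
by rewrite disjoint_sym disjoints_subset subUset sub1set inE wU
  -disjoints_subset disjoint_sym.
Qed.

Lemma spanning_tree v : connected_graph e -> rooted_tree v setT.
Proof.
move=> e_conn.
suff grow n U : (#|~: U| < n)%N -> rooted_tree v U -> rooted_tree v setT.
  exact: (grow _ _ (ltnSn _) (Root v)).
elim: n U => // n IHn U ltUn tU.
have [<- //|UT] := eqVneq U setT.
have [/exists_inP[u uU /exists_inP[w uw wU]]|U_closed] :=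
    boolP [exists u in U, exists w in e u, w \notin U].
  apply: (IHn (w |: U)); last exact: (@rooted_tree_add_leaf _ _ u).
  rewrite ltnS in ltUn; apply: leq_trans ltUn; apply: proper_card.
  rewrite properC; apply/properP; split; first exact: subsetUr.
  by exists w => //; rewrite !inE eqxx.
(* No edge leaves [U], so every path starting at [v] stays in [U], and connectedness makes [U]
   everything. *)
case/eqP: UT; apply/setP => y; rewrite inE.
have /connectP[s vs ->] := e_conn v y; have vU := rooted_tree_root tU.
elim: s {y tU IHn} v vs vU => //= w s IHs u.
move=> /andP[uw ws] uU; apply: IHs => //; apply: contraNT U_closed => wU.
by apply/exists_inP; exists u => //; apply/exists_inP; exists w.
Qed.

(** Staying on [T] instead of a subtype lets paths inside different sets be compared and
    concatenated. *)
Definition restrict (A : {set T}) : rel T :=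
  [rel x y | [&& x \in A, y \in A & e x y]].

Lemma connect_restrict_sub (A B : {set T}) x y :
  A \subset B -> connect (restrict A) x y -> connect (restrict B) x y.
Proof.
move=> /subsetP sAB; apply: connect_sub => u w /= /and3P[uA wA uw].
by apply: connect1; rewrite /restrict /= !sAB.
Qed.

Lemma rooted_tree_connect v A x :
  rooted_tree v A -> x \in A -> connect (restrict A) v x.
Proof.
move=> tA; elim: tA x => {v A} [v|v w U W tU IHU tW IHW vw _] x.
  by rewrite inE => /eqP->.
rewrite inE => /orP[xU|xW].
  by apply: connect_restrict_sub (IHU x xU); apply: subsetUl.
apply: connect_trans (connect_restrict_sub (subsetUr U W) (IHW x xW)).
apply: connect1; rewrite /restrict /= !inE (rooted_tree_root tU).
by rewrite (rooted_tree_root tW) orbT.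
Qed.

Lemma connect_induced (A : {set T}) (x y : {x : T | x \in A}) :
  connect (restrict A) (val x) (val y) -> connect (@induced T e A) x y.
Proof.
move=> /connectP[s]; elim: s x => [|z s IHs] x /=.
  by move=> _ /val_inj->.
move=> /andP[/and3P[_ zA xz] zs] yE.
exact: connect_trans (connect1 (y := Sub z zA) xz) (IHs (Sub z zA) zs yE).
Qed.

Lemma rooted_tree_connected v A :
  symmetric e -> rooted_tree v A -> connected_set e A.
Proof.
move=> e_sym tA x y.
have vA := rooted_tree_root tA.
have to z := @connect_induced A (Sub v vA) z (rooted_tree_connect tA (valP z)).
apply: connect_trans (to y); rewrite sym_connect_sym //.
by move=> u w; apply: e_sym.
Qed.

End RootedTrees.

(** [S] need not contain all the sums. Asking each witness [A] to be a tree rooted at [v] is what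
    lets [Graft] join two witnesses. *)
Lemma rooted_tree_sums (p : nat) (T : finType) (e : rel T) (l : T -> 'Z_p) v U :
  prime p -> symmetric e -> zero_avoiding e l -> rooted_tree e v U ->
  exists2 S : {set 'Z_p}, (minn p #|U| <= #|S|)%N &
    forall s, s \in S ->
      exists A : {set T}, [/\ A \subset U, rooted_tree e v A & label_sum l A = s].
Proof.
move=> p_prime e_sym l_avoid.
elim=> {v U} [v|v w U W tU [S cS hS] tW [R cR hR] vw dUW].
  exists [set l v]; first by rewrite !cards1 geq_minr.
  move=> s; rewrite inE => /eqP->; exists [set v].
  by split; [exact: subxx | exact: Root | rewrite /label_sum big_set1].
have R0 : 0 \notin R.
  apply/negP => /hR[A [_ tA /eqP]]; apply/negP/l_avoid.
    by apply/set0Pn; exists w; exact: rooted_tree_root tA.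
  exact: rooted_tree_connected tA.
exists (sumset S (0 |: R)).
  have S0 : S != set0.
    have U0 : (0 < #|U|)%N.
      by apply/card_gt0P; exists v; exact: rooted_tree_root tU.
    by rewrite -card_gt0; apply: leq_trans cS; rewrite leq_min prime_gt0.
  (* The new element 0 makes up for the [-1] in the Cauchy-Davenport bound. *)
  have := Cauchy_Davenport p_prime S0 (setU11 0 R).
  rewrite cardsU1 R0; move: dUW; rewrite -leq_card_setU => /eqP->.
  by move: cS cR; lia.
move=> _ /imset2P[s r /hS[A [sAU tA <-]] + ->].
rewrite in_setU1 => /orP[/eqP->|/hR[B [sBW tB <-]]].
  by exists A; split; rewrite ?addr0 // subsetU ?sAU.
have dAB : [disjoint A & B] by apply: disjointWl sAU (disjointWr sBW dUW).
exists (A :|: B); split; first exact: setUSS.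
  exact: Graft tA tB vw dAB.
by rewrite /label_sum -bigU //; apply: eq_bigl => x; rewrite !inE.
Qed.

(* For prime p, 'Z_p is the ring of integers modulo p. *)
Theorem theorem1p1 (p : nat) (p_prime : prime p) (T : finType) (e : rel T)
    (e_simple : simple_graph e) (e_conn : connected_graph e) :
  zero_forcing 'Z_p e <-> (p <= #|T|)%N.
Proof.
have [e_sym _] := e_simple; split=> [forcing | le_pT [l l_avoid]].
  rewrite leqNgt; apply/negP => lt_Tp; apply: forcing.
  exists (fun=> 1) => A A0 _; rewrite /label_sum sumr_const.
  (* The sum is [#|A|] modulo [p], and [0 < #|A| < p]. *)
  apply/eqP => /(congr1 (@nat_of_ord _)); rewrite val_Zp_nat ?prime_gt1 //= modn_small.
    by apply/eqP; rewrite cards_eq0.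
  exact: leq_ltn_trans (max_card _) lt_Tp.
have /card_gt0P[v _] := leq_trans (prime_gt0 p_prime) le_pT.
have [S cS hS] :=
  rooted_tree_sums p_prime e_sym l_avoid (spanning_tree v e_conn).
have ST : S = setT.
  apply/eqP; rewrite eqEcard subsetT cardsT card_Zp_prime //.
  by move: cS; rewrite cardsT (minn_idPl le_pT).
have [|A [_ tA]] := hS 0; first by rewrite ST inE.
apply/eqP/l_avoid; last exact: rooted_tree_connected tA.
by apply/set0Pn; exists v; exact: rooted_tree_root tA.
Qed.
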